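(* The map $\mathcal{P}:\mathbf{SDS}\to\mathbf{OBD}$ is a contravariant functor.
   Context: **Bratteli diagrams.** A Bratteli diagram $(V,E)$ consists of a vertex set $V=V_0\sqcup V_1\sqcup\cdots$ with each $V_n$ finite and non-empty and $V_0$ a singleton, and an edge set $E=E_1\sqcup E_2\sqcup\cdots$ with each $E_n$ finite and non-empty, together with maps $r,s:E\to V$ (range, source) such that $r(E_n)\subseteq V_n$, $s(E_n)\subseteq V_{n-1}$, $s^{-1}\{v\}\neq\varnothing$ for all $v\in V$ and $r^{-1}\{v\}\ne\varnothing$ for all $v\in V\setminus V_0$. An ordered Bratteli diagram $(V,E,\geq)$ is a Bratteli diagram with a partial order on $E$ such that $e,e'$ are comparable iff $r(e)=r(e')$. **Edge sets.** An ordered edge set from a finite set $S$ to a finite set $T$ is a finite set $F$ with maps $s:F\to S$, $r:F\to T$ and a linear order on each $r^{-1}\{w\}$, $w\in T$. If $G$ is an ordered edge set from $T$ to $U$, then $F\circ G=\{(e,g)\in F\times G: r(e)=s(g)\}$, with source $s(e)$, range $r(g)$, and order: for $r(g)=r(g')$, $(e,g)<(e',g')$ iff $g<g'$, or $g=g'$ and $e<e'$. Write $F\cong F'$ if there is a bijection $F\to F'$ preserving sources, ranges and order. For $k<l$, $E_{k,l}=E_{k+1}\circ\cdots\circ E_l$; $E_{k,k}$ consists of one edge from $v$ to $v$ for each $v\in V_k$. **The category $\mathbf{OBD}$.** Objects: ordered Bratteli diagrams. An ordered premorphism $f:B=(V,E,\ge)\to C=(W,S,\ge)$ is a triple $(F,(f_n)_{n\ge0},\geq)$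 where $(f_n)$ is an unbounded sequence of integers with $0=f_0\le f_1\le\cdots$, and $F=F_0\sqcup F_1\sqcup\cdots$ where each $F_n$ is a non-empty finite ordered edge set from $V_n$ to $W_{f_n}$ such that every $v\in V_n$ is the source of some edge of $F_n$ (that is, $s^{-1}\{v\}\neq\varnothing$ for all $v\in V$) and every $w\in W_{f_n}$ is the range of some edge of $F_n$, $F_0$ is a singleton, and $E_{n+1}\circ F_{n+1}\cong F_n\circ S_{f_n,f_{n+1}}$ for all $n\ge0$. The composition of $f:B\to C$ and $g=(G,(g_n),\ge):C\to D$ is $gf=(H,(h_n),\ge)$ with $h_n=g_{f_n}$, $H_n=F_n\circ G_{f_n}$. Premorphisms $f,g:B\to C$ are equivalent if there are positive integers $n_1<m_1<n_2<m_2<\cdots$ with $f_{n_k}<g_{m_k}<f_{n_{k+1}}$ and, for all $k\ge1$, $E_{n_k,m_k}\circ G_{m_k}\cong F_{n_k}\circ S_{f_{n_k},g_{m_k}}$ and $E_{m_k,n_{k+1}}\circ F_{n_{k+1}}\cong G_{m_k}\circ S_{g_{m_k},f_{n_{k+1}}}$. Morphisms in $\mathbf{OBD}$ are equivalence classes $[f]$, with $[g][f]=[gf]$. **The category $\mathbf{SDS}$.** An essentially minimal totally disconnected dynamical system $(X,\varphi,x_0)$ consists of a metrizable compact totally disconnected space $X$, a homeomorphism $\varphi$ of $X$ such that $(X,\varphi)$ has a unique minimal (non-empty closed invariant) subset, and a point $x_0$ of that subset. A Kakutani–Rokhlin partition for it is a finite partition $P=\{Z(k,j): 1\le k\le K,\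 1\le j\le J(k)\}$ of $X$ into non-empty clopen sets with $\varphi(Z(k,j))=Z(k,j+1)$ for $1\le j<J(k)$, and such that the top $Z=\bigcup_kZ(k,J(k))$ contains $x_0$ and $\varphi(Z)=\bigcup_kZ(k,1)$; the sequences $(Z(k,1),\ldots,Z(k,J(k)))$ are its towers. A system of Kakutani–Rokhlin partitions is a sequence $\mathcal{R}=(P_n)_{n\ge0}$ of such partitions with $P_0=\{X\}$, $P_{n+1}$ refining $P_n$ (written $P_n\le P_{n+1}$), the tops $Z_n$ of $P_n$ ($n\ge1$) decreasing with intersection $\{x_0\}$, and $\bigcup_nP_n$ a basis for the topology of $X$. Objects of $\mathbf{SDS}$ are quadruples $(X,\varphi,x_0,\mathcal{R})$; morphisms $(X,\varphi,x_0,\mathcal{R})\to(Y,\psi,y_0,\mathcal{S})$ are continuous maps $\alpha:X\to Y$ with $\alpha\circ\varphi=\psi\circ\alpha$ and $\alpha(x_0)=y_0$. **The edge set $E(P,Q)$.** If $P\le Q$ are Kakutani–Rokhlin partitions and the top of $P$ contains the top of $Q$, $E(P,Q)$ is the set of triples $(S,T,k)$ with $S=(Z_1,\ldots,Z_n)$ a tower of $P$, $T=(Y_1,\ldots,Y_m)$ a tower of $Q$, $k\ge0$ an integer with $Y_{k+j}\subseteq Z_j$ for $1\le j\le n$; source $S$, range $T$, and $(S,T,k)\le(S',T',k')$ iff $T=T'$ and $k\le k'$. **The map $\mathcal{P}$.** On objects with $\mathcal{R}=(P_n)$: $\mathcal{P}(X,\varphi,x_0,\mathcal{R})$ is the ordered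 Bratteli diagram with $V_n=\{(n,T): T\text{ a tower of }P_n\}$ and $E_n$ the copy $\{(n,S,T,k):(S,T,k)\in E(P_{n-1},P_n)\}$ of $E(P_{n-1},P_n)$ with its order. For a morphism $\alpha:(X,\varphi,x_0,(P_n))\to(Y,\psi,y_0,(Q_n))$, let $\alpha^{-1}(Q_n)$ be the set of inverse images of elements of $Q_n$, a Kakutani–Rokhlin partition for $(X,\varphi,x_0)$; for a tower $S=(Z_1,\ldots,Z_m)$ of $Q_n$ write $\alpha^{-1}(S)=(\alpha^{-1}(Z_1),\ldots,\alpha^{-1}(Z_m))$. Choose integers $0=f_0\le f_1\le\cdots$, unbounded, with $\alpha^{-1}(Q_n)\le P_{f_n}$ and the top of $\alpha^{-1}(Q_n)$ containing the top of $P_{f_n}$; let $F_n=\{(n,S,T,k):(\alpha^{-1}(S),T,k)\in E(\alpha^{-1}(Q_n),P_{f_n})\}$ with source $(n,S)$, range $(f_n,T)$ and the induced order ($F_0$ a single edge). Then $f=(\bigsqcup F_n,(f_n),\ge)$ is an ordered premorphism $\mathcal{P}(Y,\psi,y_0,(Q_n))\to\mathcal{P}(X,\varphi,x_0,(P_n))$, and $\mathcal{P}(\alpha)=[f]$.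
   Formalization: Morphisms of SDS are additionally required to have every inverse image α⁻¹(Q_n) a Kakutani–Rokhlin partition (equivalently, α is surjective); for non-surjective α the edge sets F_n do not form an ordered premorphism and P(α) is undefined. *)

(* Defs.v *)
From HB Require Import structures.
From mathcomp Require Import all_boot all_order all_algebra.
From mathcomp Require Import all_classical reals topology.

Set Implicit Arguments.
Unset Strict Implicit.
Unset Printing Implicit Defensive.

Import Order.TTheory GRing.Theory Num.Theory.

Local Open Scope classical_set_scope.

(** * Categories and contravariant functors *)

Record category := Category {
  obj :> Type;
  hom : obj -> obj -> Type;
  idm : forall X : obj, hom X X;
  compm : forall X Y Z : obj, hom Y Z -> hom X Y -> hom X Z;
  compm1 : forall (X Y : obj) (f : hom X Y), compm f (idm X) = f;
  comp1m : forall (X Y : obj) (f : hom X Y), compm (idm Y) f = f;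
  compmA : forall (X Y Z T : obj) (h : hom Z T) (g : hom Y Z) (f : hom X Y),
    compm h (compm g f) = compm (compm h g) f }.

Arguments hom {c} X Y.
Arguments idm {c} X.
Arguments compm {c X Y Z} g f.

Definition is_contravariant_functor (C D : category) (F0 : C -> D)
    (F1 : forall X Y : C, hom X Y -> hom (F0 Y) (F0 X)) : Prop :=
  (forall X : C, F1 X X (idm X) = idm (F0 X)) /\
  (forall (X Y Z : C) (g : hom Y Z) (f : hom X Y),
     F1 X Z (compm g f) = compm (F1 X Y f) (F1 Y Z g)).

Arguments is_contravariant_functor {C D} F0 F1.

(** * Ordered edge sets *)

(* A linear order on each fibre of [rng] is the same thing as a partial order
   on all edges for which two edges are comparable iff they have the same
   range. *)
Record edge_set (S T : finType) := EdgeSet {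
  edge :> finType;
  src : edge -> S;
  rng : edge -> T;
  ele : rel edge;
  ele_refl : reflexive ele;
  ele_anti : antisymmetric ele;
  ele_trans : transitive ele;
  ele_comparable : forall e e' : edge,
    ele e e' || ele e' e = (rng e == rng e') }.

Definition edge_iso (S T : finType) (F G : edge_set S T) : Prop :=
  exists h : F -> G,
    [/\ bijective h, forall e, src (h e) = src e, forall e, rng (h e) = rng e &
        forall e e', ele (h e) (h e') = ele e e'].

Notation "F \cong G" := (edge_iso F G) (at level 70, no associativity).

Section Composition.
Variables (S T U : finType) (F : edge_set S T) (G : edge_set T U).

Definition comp_edge : finType := {p : F * G | rng p.1 == src p.2}.

Definition comp_le : rel comp_edge := fun p q =>
  let: (e, g) := val p in let: (e', g') := val q in
  (g != g') && ele g g' || (g == g') && ele e e'.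

Lemma comp_le_refl : reflexive comp_le.
Proof. by case=> -[e g] h; rewrite /comp_le /= !ele_refl eqxx. Qed.

Lemma comp_le_anti : antisymmetric comp_le.
Proof.
case=> -[e g] h [[e' g'] h']; rewrite /comp_le /= => H; apply: val_inj => /=; move: H.
have [<-|ne] := eqVneq g g'; first by move=> /= /ele_anti ->.
by rewrite /= !orbF => /ele_anti gg; rewrite gg eqxx in ne.
Qed.

Lemma comp_le_trans : transitive comp_le.
Proof.
case=> -[e2 g2] h2 [[e1 g1] h1] [[e3 g3] h3]; rewrite /comp_le /=.
have [<-|n12] := eqVneq g1 g2; have [<-|n23] := eqVneq g1 g3.
- by rewrite /= ; apply: ele_trans.
- by rewrite /= !orbF.
- rewrite /= orbF eq_sym n12 /= (negPf n12) /= orbF => a b.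
  by move: n12; rewrite (ele_anti (introT andP (conj a b))) eqxx.
- rewrite /= orbF; have [<-|n23'] := eqVneq g2 g3; first by rewrite orbF.
  by rewrite /= !orbF; apply: ele_trans.
Qed.

Lemma comp_le_comparable (p q : comp_edge) :
  comp_le p q || comp_le q p = (rng (val p).2 == rng (val q).2).
Proof.
case: p q => -[e g] h [[e' g'] h']; rewrite /comp_le /= [g' == g]eq_sym.
have [gg|ne] := eqVneq g g'; last by rewrite /= !orbF ele_comparable.
rewrite /= ele_comparable; move: h h' => /= /eqP -> /eqP ->.
by rewrite gg !eqxx.
Qed.

Definition comp_edges : edge_set S U :=
  @EdgeSet S U comp_edge (fun p => src (val p).1) (fun p => rng (val p).2)
    comp_le comp_le_refl comp_le_anti comp_le_trans comp_le_comparable.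

End Composition.

Notation "F \circ G" := (comp_edges F G) (at level 40, left associativity).

Lemma eq_le_anti (S : eqType) : antisymmetric (@eq_op S).
Proof. by move=> x y /andP[/eqP]. Qed.

Lemma eq_le_comparable (S : eqType) (x y : S) : (x == y) || (y == x) = (x == y).
Proof. by rewrite [y == x]eq_sym orbb. Qed.

Definition id_edges (S : finType) : edge_set S S :=
  @EdgeSet S S S id id eq_op (@eqxx S) (@eq_le_anti S)
    (@eq_op_trans S) (@eq_le_comparable S).

Lemma void_comparable (S T : finType) (r : void -> T) (e e' : void) :
  false || false = (r e == r e').
Proof. by case: e. Qed.

Definition void_edges (S T : finType) : edge_set S T :=
  @EdgeSet S T void (of_void S) (of_void T) (fun _ _ => false)
    (fun x => match x with end) (fun x => match x with end)
    (fun x => match x with end) (@void_comparable S T (of_void T)).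

Definition comp_pair (S T U : finType) (F : edge_set S T) (G : edge_set T U)
  (e : F) (g : G) (eg : rng e == src g) : F \circ G := exist _ (e, g) eg.

Section IsoTheory.
Implicit Types S T U W : finType.

Lemma iso_refl S T (F : edge_set S T) : F \cong F.
Proof. by exists id; split=> //; exists id. Qed.

Lemma iso_sym S T (F G : edge_set S T) : F \cong G -> G \cong F.
Proof.
case=> h [[k hk kh] hs hr hl]; exists k; split.
- by exists h.
- by move=> e; rewrite -hs kh.
- by move=> e; rewrite -hr kh.
- by move=> e e'; rewrite -hl !kh.
Qed.

Lemma iso_trans S T (F G H : edge_set S T) : F \cong G -> G \cong H -> F \cong H.
Proof.
case=> h [bh hs hr hl] [k [bk ks kr kl]]; exists (k \o h); split.
- exact: bij_comp.
- by move=> e; rewrite /= ks hs.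
- by move=> e; rewrite /= kr hr.
- by move=> e e'; rewrite /= kl hl.
Qed.

Lemma iso_comp S T U (F F' : edge_set S T) (G G' : edge_set T U) :
  F \cong F' -> G \cong G' -> F \circ G \cong F' \circ G'.
Proof.
case=> h [[h' hh h'h] hs hr hl] [k [[k' kk k'k] ks kr kl]].
have ok (p : F \circ G) : rng (h (val p).1) == src (k (val p).2).
  by rewrite hr ks; case: p.
have ok' (p : F' \circ G') : rng (h' (val p).1) == src (k' (val p).2).
  by rewrite -hr -ks h'h k'k; case: p.
exists (fun p => exist _ (h (val p).1, k (val p).2) (ok p)); split=> /=.
- exists (fun p => exist _ (h' (val p).1, k' (val p).2) (ok' p)).
    by move=> [[e g] p]; apply: val_inj; rewrite /= hh kk.
  by move=> [[e g] p]; apply: val_inj; rewrite /= h'h k'k.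
- by move=> e; rewrite hs.
- by move=> e; rewrite kr.
- move=> [[e g] p] [[e' g'] p']; rewrite /comp_le /= kl hl.
  by rewrite (inj_eq (can_inj kk)).
Qed.

Lemma iso_compA S T U W (F : edge_set S T) (G : edge_set T U)
    (H : edge_set U W) : F \circ (G \circ H) \cong (F \circ G) \circ H.
Proof.
pose a (p : F \circ (G \circ H)) : (F \circ G) \circ H :=
  @comp_pair _ _ _ _ _ (@comp_pair _ _ _ _ _ (val p).1 (val (val p).2).1 (valP p))
    (val (val p).2).2 (valP (val p).2).
pose b (p : (F \circ G) \circ H) : F \circ (G \circ H) :=
  @comp_pair _ _ _ _ _ (val (val p).1).1
    (@comp_pair _ _ _ _ _ (val (val p).1).2 (val p).2 (valP p)) (valP (val p).1).
exists a; split=> //=.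
- exists b.
    case=> -[e [[g h] q]] p; apply: val_inj => /=; congr pair.
    exact: val_inj.
  case=> -[[[e g] q] h] p; apply: val_inj => /=; congr pair.
  exact: val_inj.
- case=> -[e [[g h] q]] p [[e' [[g' h'] q']] p'].
  rewrite /comp_le /= -!val_eqE /= /comp_le /= !xpair_eqE.
  case: (g == g'); case: (h == h'); case: (e == e'); rewrite /= ?orbF //.
Qed.

Lemma iso_compm1 S T (F : edge_set S T) : F \circ id_edges T \cong F.
Proof.
have ok (e : F) : rng (e, rng e : id_edges T).1
    == src (e, rng e : id_edges T).2 by [].
exists (fun p => (val p).1); split=> //=.
- exists (fun e => exist _ (e, rng e) (ok e)) => //.
  by case=> -[e v] p; apply: val_inj => /=; rewrite (eqP p).
- by case=> -[e v] p; rewrite /= (eqP p).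
- case=> -[e v] p [[e' v'] p']; rewrite /comp_le /=.
  move: p p' => /= /eqP p /eqP p'; case: eqVneq => //= vv.
  have := ele_comparable e e'; rewrite p p' (negPf vv).
  by case: ele.
Qed.

Lemma iso_comp1m S T (F : edge_set S T) : id_edges S \circ F \cong F.
Proof.
have ok (e : F) : rng (src e : id_edges S, e).1
    == src (src e : id_edges S, e).2 by rewrite /= eqxx.
exists (fun p => (val p).2); split=> //=.
- exists (fun e => exist _ (src e, e) (ok e)) => //.
  by case=> -[v e] p; apply: val_inj => /=; rewrite -(eqP p).
- by case=> -[v e] p; rewrite /= -(eqP p).
- case=> -[v e] p [[v' e'] p']; rewrite /comp_le /=.
  move: p p' => /= /eqP -> /eqP ->.
  by case: eqVneq => [->|_]; rewrite /= ?eqxx ?ele_refl ?orbF.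
Qed.

End IsoTheory.

(** * Ordered Bratteli diagrams *)

(* The disjoint unions V = V_0 + V_1 + ... and E = E_1 + E_2 + ... are given by
   their levels; [bedges n] is E_{n+1}. *)
Record bratteli := Bratteli {
  bvert : nat -> finType;
  bedges : forall n, edge_set (bvert n) (bvert n.+1);
  bvert_nonempty : forall n, (0 < #|bvert n|)%N;
  bvert_root : #|bvert 0| = 1%N;
  bedges_nonempty : forall n, (0 < #|bedges n|)%N;
  bedges_src : forall n (v : bvert n), exists e : bedges n, src e = v;
  bedges_rng : forall n (w : bvert n.+1), exists e : bedges n, rng e = w }.

(* E_{k,l}, as an edge set between levels k and l; the value is irrelevant
   (namely empty) when l < k. *)
Fixpoint paths (V : nat -> finType) (E : forall n, edge_set (V n) (V n.+1))
    (k l : nat) {struct l} : edge_set (V k) (V l) :=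
  if k =P l is ReflectT kl
  then ecast i (edge_set (V k) (V i)) kl (id_edges (V k))
  else match l return edge_set (V k) (V l) with
       | 0 => void_edges (V k) (V 0)
       | l'.+1 => paths E k l' \circ E l'
       end.

Definition bpaths (B : bratteli) (k l : nat) : edge_set (bvert B k) (bvert B l) :=
  paths (@bedges B) k l.

Lemma bpaths_id (B : bratteli) k : bpaths B k k = id_edges (bvert B k).
Proof.
rewrite /bpaths; case: k => [|k] /=; case: eqP => // p;
  by rewrite (eq_irrelevance p erefl).
Qed.

Lemma bpathsS (B : bratteli) k l : (k <= l)%N ->
  bpaths B k l.+1 = bpaths B k l \circ bedges B l.
Proof.
by move=> kl; rewrite /bpaths /=; case: eqP => // p; rewrite p ltnn in kl.
Qed.

Lemma bpaths_cat (B : bratteli) k l m : (k <= l)%N -> (l <= m)%N ->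
  bpaths B k l \circ bpaths B l m \cong bpaths B k m.
Proof.
move=> kl; elim: m => [|m IH] lm.
  have l0 : l = 0%N by apply/eqP; rewrite -leqn0.
  by subst l; rewrite bpaths_id; apply: iso_compm1.
move: lm; rewrite leq_eqVlt => /predU1P[<-|lm].
  by rewrite bpaths_id; apply: iso_compm1.
rewrite !bpathsS ?(leq_trans kl lm) //.
apply: iso_trans (iso_compA _ _ _) _.
by apply: iso_comp; [exact: IH|exact: iso_refl].
Qed.

(** * Ordered premorphisms *)

Record premorphism (B C : bratteli) := Premorphism {
  pidx : nat -> nat;
  pedges : forall n, edge_set (bvert B n) (bvert C (pidx n));
  pidx0 : pidx 0%N = 0%N;
  pidx_le : forall n, (pidx n <= pidx n.+1)%N;
  pidx_unbounded : forall N, exists n, (N < pidx n)%N;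
  pedges_nonempty : forall n, (0 < #|pedges n|)%N;
  pedges_src : forall n (v : bvert B n), exists e : pedges n, src e = v;
  pedges_rng : forall n (w : bvert C (pidx n)), exists e : pedges n, rng e = w;
  pedges0 : #|pedges 0| = 1%N;
  pedges_comm : forall n,
    bedges B n \circ pedges n.+1 \cong
    pedges n \circ bpaths C (pidx n) (pidx n.+1) }.

(* The sequences n_1 < m_1 < n_2 < ... are indexed from 0. *)
Definition premor_equiv (B C : bratteli) (f g : premorphism B C) : Prop :=
  exists n m : nat -> nat,
    (0 < n 0)%N /\
    forall k,
      [/\ (n k < m k)%N, (m k < n k.+1)%N,
          (pidx f (n k) < pidx g (m k))%N,
          (pidx g (m k) < pidx f (n k.+1))%N &
          bpaths B (n k) (m k) \circ pedges g (m k) \cong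
          pedges f (n k) \circ bpaths C (pidx f (n k)) (pidx g (m k)) /\
          bpaths B (m k) (n k.+1) \circ pedges f (n k.+1) \cong
          pedges g (m k) \circ bpaths C (pidx g (m k)) (pidx f (n k.+1))].

Section PremorphismTheory.
Variables B C : bratteli.
Implicit Types f g h : premorphism B C.

Lemma pidx_mono f m n : (m <= n)%N -> (pidx f m <= pidx f n)%N.
Proof.
elim: n => [|n IH]; first by rewrite leqn0 => /eqP ->.
rewrite leq_eqVlt => /predU1P[->//|/IH mn].
exact: leq_trans mn (pidx_le f n).
Qed.

Lemma pidx_large f N : exists M, forall n, (M <= n)%N -> (N < pidx f n)%N.
Proof.
have [M NM] := pidx_unbounded f N.
by exists M => n /(pidx_mono f); apply: leq_trans.
Qed.

Lemma pedges_paths f k l : (k <= l)%N ->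
  bpaths B k l \circ pedges f l \cong
  pedges f k \circ bpaths C (pidx f k) (pidx f l).
Proof.
elim: l => [|l IH].
  rewrite leqn0 => /eqP ->; rewrite !bpaths_id.
  exact: iso_trans (iso_comp1m _) (iso_sym (iso_compm1 _)).
rewrite leq_eqVlt => /predU1P[->|kl].
  by rewrite !bpaths_id; apply: iso_trans (iso_comp1m _) (iso_sym (iso_compm1 _)).
rewrite bpathsS //.
apply: iso_trans (iso_sym (iso_compA _ _ _)) _.
apply: iso_trans (iso_comp (iso_refl _) (pedges_comm f l)) _.
apply: iso_trans (iso_compA _ _ _) _.
apply: iso_trans (iso_comp (IH kl) (iso_refl _)) _.
apply: iso_trans (iso_sym (iso_compA _ _ _)) _.
apply: iso_comp (iso_refl _) _.
by apply: bpaths_cat; [exact: pidx_mono|exact: pidx_le].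
Qed.

(* One half of an intertwining, in the weakest and in the strongest form. *)
Definition intertwines f g n m : Prop :=
  [/\ (n <= m)%N, (pidx f n <= pidx g m)%N &
      bpaths B n m \circ pedges g m \cong
      pedges f n \circ bpaths C (pidx f n) (pidx g m)].

Lemma intertwines_ge f g n m p :
  (m <= p)%N -> intertwines f g n m -> intertwines f g n p.
Proof.
move=> mp [nm fg I]; split; first exact: leq_trans mp.
  exact: leq_trans fg (pidx_mono g mp).
apply: iso_trans (iso_comp (iso_sym (bpaths_cat _ nm mp)) (iso_refl _)) _.
apply: iso_trans (iso_sym (iso_compA _ _ _)) _.
apply: iso_trans (iso_comp (iso_refl _) (pedges_paths g mp)) _.
apply: iso_trans (iso_compA _ _ _) _.
apply: iso_trans (iso_comp I (iso_refl _)) _.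
apply: iso_trans (iso_sym (iso_compA _ _ _)) _.
by apply: iso_comp (iso_refl _) (bpaths_cat _ fg (pidx_mono g mp)).
Qed.

Lemma intertwines_le f g k n m :
  (k <= n)%N -> intertwines f g n m -> intertwines f g k m.
Proof.
move=> kn [nm fg I]; split; first exact: leq_trans nm.
  exact: leq_trans (pidx_mono f kn) fg.
apply: iso_trans (iso_comp (iso_sym (bpaths_cat _ kn nm)) (iso_refl _)) _.
apply: iso_trans (iso_sym (iso_compA _ _ _)) _.
apply: iso_trans (iso_comp (iso_refl _) I) _.
apply: iso_trans (iso_compA _ _ _) _.
apply: iso_trans (iso_comp (pedges_paths f kn) (iso_refl _)) _.
apply: iso_trans (iso_sym (iso_compA _ _ _)) _.
by apply: iso_comp (iso_refl _) (bpaths_cat _ (pidx_mono f kn) fg).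
Qed.

Lemma intertwines_trans f g h n m p :
  intertwines f g n m -> intertwines g h m p -> intertwines f h n p.
Proof.
move=> [nm fg I] [mp gh J]; split; first exact: leq_trans mp.
  exact: leq_trans gh.
apply: iso_trans (iso_comp (iso_sym (bpaths_cat _ nm mp)) (iso_refl _)) _.
apply: iso_trans (iso_sym (iso_compA _ _ _)) _.
apply: iso_trans (iso_comp (iso_refl _) J) _.
apply: iso_trans (iso_compA _ _ _) _.
apply: iso_trans (iso_comp I (iso_refl _)) _.
apply: iso_trans (iso_sym (iso_compA _ _ _)) _.
exact: iso_comp (iso_refl _) (bpaths_cat _ fg gh).
Qed.

Definition absorbs f g : Prop := forall n, exists m, intertwines f g n m.

Lemma premor_equivP f g : premor_equiv f g <-> absorbs f g /\ absorbs g f.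
Proof.
split=> [[n [m [n0 H]]]|[fg gf]].
  have nk k : (k <= n k)%N.
    elim: k => // k IH; have [a b _ _ _] := H k.
    exact: leq_ltn_trans IH (leq_ltn_trans (ltnW a) b).
  have mk k : (k <= m k)%N.
    by have [a _ _ _ _] := H k; exact: leq_trans (nk k) (ltnW a).
  split=> k.
    exists (m k); apply: intertwines_le (nk k) _.
    by have [/ltnW a _ /ltnW b _ [I _]] := H k.
  exists (n k.+1); apply: intertwines_le (mk k) _.
  by have [_ /ltnW a _ /ltnW b [_ I]] := H k.
have next f' g' : absorbs f' g' -> forall n, exists m,
    [/\ (n < m)%N, (pidx f' n < pidx g' m)%N & intertwines f' g' n m].
  move=> ab n; have [m I] := ab n.
  have [M HM] := pidx_large g' (pidx f' n).
  exists (maxn m (maxn n.+1 M)); split.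
  - by rewrite !leq_max leqnn orbT.
  - by apply: HM; rewrite !leq_max leqnn !orbT.
  - by apply: intertwines_ge I; rewrite leq_maxl.
have [s Hs] := choice (next _ _ fg).
have [t Ht] := choice (next _ _ gf).
pose n k := iter k (t \o s) 1%N.
exists n, (s \o n); split=> // k.
have [a b [_ _ I]] := Hs (n k); have [c d [_ _ J]] := Ht (s (n k)).
by split.
Qed.

Lemma absorbs_trans f g h : absorbs f g -> absorbs g h -> absorbs f h.
Proof.
move=> fg gh n; have [m I] := fg n; have [p J] := gh m.
by exists p; apply: intertwines_trans I J.
Qed.

Lemma premor_equiv_refl f : premor_equiv f f.
Proof.
apply/premor_equivP; split=> n; exists n; split=> //; exact: pedges_paths.
Qed.

Lemma premor_equiv_sym f g : premor_equiv f g -> premor_equiv g f.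
Proof. by move=> /premor_equivP[? ?]; apply/premor_equivP. Qed.

Lemma premor_equiv_trans f g h :
  premor_equiv f g -> premor_equiv g h -> premor_equiv f h.
Proof.
move=> /premor_equivP[fg gf] /premor_equivP[gh hg]; apply/premor_equivP.
by split; [exact: absorbs_trans fg gh|exact: absorbs_trans hg gf].
Qed.

End PremorphismTheory.

Section IdPremorphism.
Variable B : bratteli.

Lemma id_premor_unbounded N : exists n, (N < n)%N.
Proof. by exists N.+1. Qed.

Lemma id_premor_onto n (v : bvert B n) :
  exists e : id_edges (bvert B n), e = v :> bvert B n.
Proof. by exists v. Qed.

Lemma id_premor_comm n :
  bedges B n \circ id_edges (bvert B n.+1) \cong
  id_edges (bvert B n) \circ bpaths B n n.+1.
Proof.
rewrite bpathsS // bpaths_id; apply: iso_trans (iso_compm1 _) _.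
apply: iso_sym; exact: iso_trans (iso_comp1m _) (iso_comp1m _).
Qed.

Definition id_premor : premorphism B B :=
  @Premorphism B B id (fun n => id_edges (bvert B n)) erefl leqnSn
    id_premor_unbounded (@bvert_nonempty B) id_premor_onto id_premor_onto
    (bvert_root B) id_premor_comm.

End IdPremorphism.

Section CompPremorphism.
Variables (B C D : bratteli) (g : premorphism C D) (f : premorphism B C).

Definition comp_idx n := pidx g (pidx f n).
Definition comp_pedges n : edge_set (bvert B n) (bvert D (comp_idx n)) :=
  pedges f n \circ pedges g (pidx f n).

Lemma comp_premor0 : comp_idx 0 = 0%N.
Proof. by rewrite /comp_idx !pidx0. Qed.

Lemma comp_premor_le n : (comp_idx n <= comp_idx n.+1)%N.
Proof. exact/pidx_mono/pidx_le. Qed.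

Lemma comp_premor_unbounded N : exists n, (N < comp_idx n)%N.
Proof.
have [m Nm] := pidx_unbounded g N; have [n mn] := pidx_unbounded f m.
by exists n; apply: leq_trans Nm (pidx_mono g (ltnW mn)).
Qed.

Lemma comp_premor_src n (v : bvert B n) : exists e : comp_pedges n, src e = v.
Proof.
have [e ev] := pedges_src f v; have [e' ee'] := pedges_src g (rng e).
have ok : rng (e, e').1 == src (e, e').2 by rewrite /= ee'.
by exists (exist _ (e, e') ok).
Qed.

Lemma comp_premor_rng n (w : bvert D (comp_idx n)) :
  exists e : comp_pedges n, rng e = w.
Proof.
have [e' ew] := @pedges_rng _ _ g _ w; have [e ee'] := @pedges_rng _ _ f _ (src e').
have ok : rng (e, e').1 == src (e, e').2 by rewrite /= ee'.
by exists (exist _ (e, e') ok).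
Qed.

Lemma comp_premor_nonempty n : (0 < #|comp_pedges n|)%N.
Proof.
have /card_gt0P[v _] := bvert_nonempty B n.
by have [e _] := comp_premor_src v; apply/card_gt0P; exists e.
Qed.

Lemma comp_premor_single : #|comp_pedges 0| = 1%N.
Proof.
apply/eqP; rewrite eqn_leq comp_premor_nonempty andbT.
have single (T : finType) (x y : T) : #|T| = 1%N -> x = y.
  by move=> T1; apply: (card_le1_eqP (A := T)) => //; rewrite T1.
have single' k (x y : pedges g k) : k = 0%N -> x = y.
  by move=> k0; move: x y; rewrite k0 => x y; apply: single (pedges0 g).
apply/card_le1_eqP => -[[e e'] p] [[d d'] q] _ _; apply: val_inj => /=.
by rewrite (single _ e d (pedges0 f)) (single' _ e' d' (pidx0 f)).
Qed.

Lemma comp_premor_comm n :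
  bedges B n \circ comp_pedges n.+1 \cong
  comp_pedges n \circ bpaths D (comp_idx n) (comp_idx n.+1).
Proof.
apply: iso_trans (iso_compA _ _ _) _.
apply: iso_trans (iso_comp (pedges_comm f n) (iso_refl _)) _.
apply: iso_trans (iso_sym (iso_compA _ _ _)) _.
apply: iso_trans (iso_comp (iso_refl _) (pedges_paths g (pidx_le f n))) _.
exact: iso_compA.
Qed.

Definition comp_premor : premorphism B D :=
  @Premorphism B D comp_idx comp_pedges comp_premor0 comp_premor_le
    comp_premor_unbounded comp_premor_nonempty comp_premor_src comp_premor_rng
    comp_premor_single comp_premor_comm.

End CompPremorphism.

Lemma absorbs_comp (B C D : bratteli) (g g' : premorphism C D)
    (f f' : premorphism B C) :
  absorbs f f' -> absorbs g g' -> absorbs (comp_premor g f) (comp_premor g' f').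
Proof.
move=> ff' gg' n; have [m0 I0] := ff' n; have [p J0] := gg' (pidx f n).
have [M HM] := pidx_large f' p.
pose m := maxn m0 M; exists m.
have [nm fm I] : intertwines f f' n m by apply: intertwines_ge I0; rewrite leq_maxl.
have /ltnW pm : (p < pidx f' m)%N by apply: HM; rewrite leq_maxr.
have [_ gm J] := intertwines_ge pm J0; split=> //.
apply: iso_trans (iso_compA _ _ _) _.
apply: iso_trans (iso_comp I (iso_refl _)) _.
apply: iso_trans (iso_sym (iso_compA _ _ _)) _.
apply: iso_trans (iso_comp (iso_refl _) J) _.
exact: iso_compA.
Qed.

Lemma comp_premor_equiv (B C D : bratteli) (g g' : premorphism C D)
    (f f' : premorphism B C) : premor_equiv f f' -> premor_equiv g g' ->
  premor_equiv (comp_premor g f) (comp_premor g' f').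
Proof.
move=> /premor_equivP[ff' f'f] /premor_equivP[gg' g'g]; apply/premor_equivP.
by split; apply: absorbs_comp.
Qed.

(** * The category OBD *)

Record obd_hom (B C : bratteli) := ObdHom {
  obd_class : premorphism B C -> Prop;
  obd_classP : exists f, obd_class = premor_equiv f }.

Definition obd_of (B C : bratteli) (f : premorphism B C) : obd_hom B C :=
  ObdHom (ex_intro _ f erefl).

Lemma obd_of_eq (B C : bratteli) (f g : premorphism B C) :
  obd_of f = obd_of g <-> premor_equiv f g.
Proof.
split=> [[fg]|fg].
  by rewrite fg; exact: premor_equiv_refl.
have E : premor_equiv f = premor_equiv g.
  apply/funext => h; apply/propext; split; apply: premor_equiv_trans => //.
  exact: premor_equiv_sym.
rewrite /obd_of; move: (ex_intro _ g _) (ex_intro _ f _); rewrite E => p q.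
by rewrite (Prop_irrelevance p q).
Qed.

Lemma obd_of_onto (B C : bratteli) (c : obd_hom B C) : exists f, c = obd_of f.
Proof.
case: c => c p; have [f cf] := p; exists f; move: p; rewrite cf => p.
by rewrite /obd_of (Prop_irrelevance p (ex_intro _ f erefl)).
Qed.

Definition obd_rep (B C : bratteli) (c : obd_hom B C) : premorphism B C :=
  sval (cid (obd_of_onto c)).

Lemma obd_repK (B C : bratteli) (c : obd_hom B C) : obd_of (obd_rep c) = c.
Proof. by rewrite /obd_rep; case: cid. Qed.

Definition obd_comp (B C D : bratteli) (g : obd_hom C D) (f : obd_hom B C) :
  obd_hom B D := obd_of (comp_premor (obd_rep g) (obd_rep f)).

Lemma obd_compE (B C D : bratteli) (g : premorphism C D) (f : premorphism B C) :
  obd_comp (obd_of g) (obd_of f) = obd_of (comp_premor g f).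
Proof. by apply/obd_of_eq/comp_premor_equiv; apply/obd_of_eq; rewrite obd_repK. Qed.

Lemma obd_compm1 (B C : bratteli) (c : obd_hom B C) :
  obd_comp c (obd_of (id_premor B)) = c.
Proof.
have [f ->] := obd_of_onto c; rewrite obd_compE; apply/obd_of_eq/premor_equivP.
split=> n; exists n; split=> //.
  apply: iso_trans (pedges_paths f (leqnn n)) _.
  exact: iso_comp (iso_sym (iso_comp1m _)) (iso_refl _).
apply: iso_trans (iso_comp (iso_refl _) (iso_comp1m _)) _.
exact: pedges_paths.
Qed.

Lemma obd_comp1m (B C : bratteli) (c : obd_hom B C) :
  obd_comp (obd_of (id_premor C)) c = c.
Proof.
have [f ->] := obd_of_onto c; rewrite obd_compE; apply/obd_of_eq/premor_equivP.
split=> n; exists n; split=> //.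
  apply: iso_trans (pedges_paths f (leqnn n)) _.
  exact: iso_comp (iso_sym (iso_compm1 _)) (iso_refl _).
apply: iso_trans (iso_comp (iso_refl _) (iso_compm1 _)) _.
exact: pedges_paths.
Qed.

Lemma obd_compA (A B C D : bratteli) (c : obd_hom C D) (b : obd_hom B C)
    (a : obd_hom A B) :
  obd_comp c (obd_comp b a) = obd_comp (obd_comp c b) a.
Proof.
have [h ->] := obd_of_onto c; have [g ->] := obd_of_onto b.
have [f ->] := obd_of_onto a; rewrite !obd_compE.
apply/obd_of_eq/premor_equivP; split=> n; exists n; split=> //.
  apply: iso_trans (iso_comp (iso_refl _) (iso_compA _ _ _)) _.
  exact: (pedges_paths (comp_premor h (comp_premor g f)) (leqnn n)).
apply: iso_trans (iso_comp (iso_refl _) (iso_sym (iso_compA _ _ _))) _.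
exact: (pedges_paths (comp_premor (comp_premor h g) f) (leqnn n)).
Qed.

Definition OBD : category :=
  @Category bratteli obd_hom (fun B => obd_of (id_premor B)) obd_comp
    obd_compm1 obd_comp1m obd_compA.

(** * Kakutani-Rokhlin partitions *)

(* A family of towers of subsets; [tower P k] is the sequence
   (Z(k,1), ..., Z(k,J(k))), so that [atom P k j] is Z(k,j+1). The towers of a
   Kakutani-Rokhlin partition are pairwise distinct, and so a tower is
   represented by its index. *)
Record towers (X : Type) := Towers {
  ntowers : nat;
  tower : 'I_ntowers -> seq (set X) }.

Section Towers.
Variables (X : Type) (P : towers X).

Definition height (k : 'I_(ntowers P)) : nat := size (tower k).
Definition atom (k : 'I_(ntowers P)) (j : nat) : set X := nth set0 (tower k) j.
Definition atoms : set (set X) :=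
  [set A | exists k j, (j < height k)%N /\ A = atom k j].
Definition top : set X := [set x | exists k, atom k (height k).-1 x].
Definition bottom : set X := [set x | exists k, atom k 0 x].

End Towers.

Record is_KR (X : topologicalType) (phi : X -> X) (x0 : X) (P : towers X) : Prop :=
  IsKR {
  KR_height : forall k : 'I_(ntowers P), (0 < height k)%N;
  KR_nonempty : forall (k : 'I_(ntowers P)) j, (j < height k)%N -> atom k j !=set0;
  KR_clopen : forall (k : 'I_(ntowers P)) j, (j < height k)%N -> clopen (atom k j);
  KR_disjoint : forall (k k' : 'I_(ntowers P)) j j',
    (j < height k)%N -> (j' < height k')%N ->
    atom k j `&` atom k' j' !=set0 -> k = k' /\ j = j';
  KR_cover : forall x, exists (k : 'I_(ntowers P)) j,
    (j < height k)%N /\ atom k j x;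
  KR_step : forall (k : 'I_(ntowers P)) j, (j.+1 < height k)%N ->
    phi @` atom k j = atom k j.+1;
  KR_base : top P x0;
  KR_return : phi @` top P = bottom P }.

(* P <= Q *)
Definition refined_by (X : Type) (P Q : towers X) : Prop :=
  forall B, atoms Q B -> exists2 A, atoms P A & B `<=` A.

Definition pullback (X Y : Type) (a : X -> Y) (Q : towers Y) : towers X :=
  Towers (fun k => [seq a @^-1` A | A <- tower (t := Q) k]).

(** * Essentially minimal systems and the category SDS *)

Definition metrizable (R : realType) (X : topologicalType) : Prop :=
  exists d : X -> X -> R,
    [/\ forall x y, d x y = 0%R <-> x = y, forall x y, d x y = d y x,
        forall x y z, (d x z <= d x y + d y z)%R &
        forall x A, nbhs x A <->
          exists e : R, (0 < e)%R /\ forall y, (d x y < e)%R -> A y].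

Definition homeomorphism (X Y : topologicalType) (f : X -> Y) : Prop :=
  continuous f /\
  exists g : Y -> X, [/\ continuous g, cancel f g & cancel g f].

Definition minimal_set (X : topologicalType) (phi : X -> X) (M : set X) : Prop :=
  [/\ M !=set0, closed M, phi @` M = M &
      forall N, N !=set0 -> closed N -> phi @` N = N -> N `<=` M -> N = M].

Record sds (R : realType) := Sds {
  space :> topologicalType;
  shift : space -> space;
  base : space;
  part : nat -> towers space;
  sds_metrizable : metrizable R space;
  sds_compact : compact [set: space];
  sds_totally_disconnected : totally_disconnected [set: space];
  sds_homeomorphism : homeomorphism shift;
  sds_minimal : exists M, [/\ minimal_set shift M,
    forall N, minimal_set shift N -> N = M & M base];
  part_KR : forall n, is_KR shift base (part n);
  part0 : atoms (part 0) = [set [set: space]];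
  part_refined : forall n, refined_by (part n) (part n.+1);
  part_top : forall n, (0 < n)%N -> top (part n.+1) `<=` top (part n);
  part_top_bigcap : \bigcap_(n in [set n | (0 < n)%N]) top (part n) = [set base];
  part_basis : basis (\bigcup_n atoms (part n)) }.

Arguments shift {R} s x.
Arguments base {R} s.
Arguments part {R} s n.

(* [sds_pullback]: the inverse images of the atoms of each partition Q_n of the
   target form a Kakutani-Rokhlin partition of the source. As its atoms must be
   non-empty, this amounts to the map being onto. It is automatic when the
   target is minimal, but not in general: the inclusion of the fixed point in
   the one-point compactification of the integers, with n |-> n + 1, satisfies
   the other conditions. When some tower of Q_n has empty inverse image it is
   the source of no edge of E(pullback Q_n, P_m), and so no premorphism can be
   built from these edge sets. *)
Record sds_hom (R : realType) (X Y : sds R) := SdsHom {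
  sds_map :> X -> Y;
  sds_continuous : continuous sds_map;
  sds_shift : sds_map \o shift X = shift Y \o sds_map;
  sds_base : sds_map (base X) = base Y;
  sds_pullback : forall n, is_KR (shift X) (base X) (pullback sds_map (part Y n)) }.

Section SdsTheory.
Variable R : realType.
Implicit Types X Y Z : sds R.

Lemma pullback_atom (S T : Type) (a : S -> T) (Q : towers T)
    (k : 'I_(ntowers Q)) j :
  atom (P := pullback a Q) k j = a @^-1` (atom k j).
Proof.
rewrite /atom /=; have [jk|jk] := ltnP j (size (tower k)).
  by rewrite (nth_map set0).
by rewrite !nth_default ?size_map // preimage_set0.
Qed.

Lemma pullback_height (S T : Type) (a : S -> T) (Q : towers T)
    (k : 'I_(ntowers Q)) :
  height (P := pullback a Q) k = height k.
Proof. by rewrite /height size_map. Qed.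

Lemma pullback_KR X Y (a : X -> Y) (Q : towers Y) :
  continuous a -> a \o shift X = shift Y \o a -> a (base X) = base Y ->
  is_KR (shift Y) (base Y) Q ->
  (forall (k : 'I_(ntowers Q)) j, (j < height k)%N -> a @^-1` (atom k j) !=set0) ->
  is_KR (shift X) (base X) (pullback a Q).
Proof.
move=> ac aphi ab KR ne.
have step A B : shift Y @` A = B -> shift X @` (a @^-1` A) = a @^-1` B.
  move=> AB; have aphiE x : a (shift X x) = shift Y (a x).
    by have := congr1 (fun f => f x) aphi.
  apply/seteqP; split=> x /=.
    by case=> y Ay <-; rewrite aphiE -AB; exists (a y).
  rewrite -AB => -[y Ay yx].
  have [_ [p [_ _ px]]] := sds_homeomorphism X.
  have [_ [q [_ qy _]]] := sds_homeomorphism Y.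
  exists (p x); last exact: px.
  suff -> : a (p x) = y by [].
  by apply: (can_inj qy); rewrite yx -aphiE px.
have topE : top (pullback a Q) = a @^-1` top Q.
  by apply/seteqP; split=> x [k xk]; exists k; move: xk;
    rewrite pullback_atom pullback_height.
have botE : bottom (pullback a Q) = a @^-1` bottom Q.
  by apply/seteqP; split=> x [k xk]; exists k; move: xk; rewrite pullback_atom.
split.
- by move=> k; rewrite pullback_height; apply: KR_height KR k.
- by move=> k j; rewrite pullback_height pullback_atom; apply: ne.
- move=> k j; rewrite pullback_height pullback_atom => jk.
  exact: preimage_clopen (KR_clopen KR jk) ac.
- move=> k k' j j'; rewrite !pullback_height !pullback_atom => jk jk' [x [A B]].
  by apply: (KR_disjoint KR jk jk'); exists (a x).
- move=> x; have [k [j [jk A]]] := KR_cover KR (a x).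
  by exists k, j; rewrite pullback_height pullback_atom.
- move=> k j; rewrite pullback_height !pullback_atom => jk.
  exact/step/(KR_step KR).
- by rewrite topE /= ab; exact: KR_base KR.
- by rewrite topE botE; exact/step/(KR_return KR).
Qed.

Lemma sds_hom_eq X Y (a b : sds_hom X Y) : (a : X -> Y) = b -> a = b.
Proof.
case: a b => [a a1 a2 a3 a4] [b b1 b2 b3 b4] /= ab; move: b1 b2 b3 b4.
by rewrite -ab => *; congr SdsHom; exact: Prop_irrelevance.
Qed.

Lemma sds_hom_dense X Y (a : sds_hom X Y) (A : set Y) :
  open A -> A !=set0 -> a @^-1` A !=set0.
Proof.
move=> oA [y Ay]; have [_ /(_ y) bas] := part_basis Y.
have [U [[n _ [k [j [jk ->]]]] Uy] UA] := bas A (open_nbhs_nbhs (conj oA Ay)).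
have := @KR_nonempty _ _ _ _ (sds_pullback a n) k j.
rewrite pullback_height pullback_atom => /(_ jk)[x xA].
by exists x; apply: UA.
Qed.

Lemma sds_id_pullback X n : is_KR (shift X) (base X) (pullback id (part X n)).
Proof.
apply: pullback_KR => // ; [by move=> x; exact: cvg_id|exact: part_KR|].
by move=> k j jk; have := KR_nonempty (part_KR X n) jk.
Qed.

Definition sds_id X : sds_hom X X :=
  @SdsHom R X X id (fun x => @cvg_id _ (nbhs x)) erefl erefl (sds_id_pullback X).

Section SdsComp.
Variables (X Y Z : sds R) (b : sds_hom Y Z) (a : sds_hom X Y).

Lemma sds_comp_continuous : continuous (b \o a).
Proof.
by move=> x; apply: continuous_comp; [exact: sds_continuous|exact: sds_continuous].
Qed.

Lemma sds_comp_shift : (b \o a) \o shift X = shift Z \o (b \o a).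
Proof. by rewrite -compA (sds_shift a) compA (sds_shift b). Qed.

Lemma sds_comp_base : (b \o a) (base X) = base Z.
Proof. by rewrite /= !sds_base. Qed.

Lemma sds_comp_pullback n :
  is_KR (shift X) (base X) (pullback (b \o a) (part Z n)).
Proof.
apply: pullback_KR; [exact: sds_comp_continuous|exact: sds_comp_shift|
  exact: sds_comp_base|exact: part_KR|].
move=> k j jk; rewrite comp_preimage; apply: sds_hom_dense.
  have [oA _] := KR_clopen (part_KR Z n) jk.
  by move: oA; apply: open_comp => x _; exact: sds_continuous.
have := @KR_nonempty _ _ _ _ (sds_pullback b n) k j.
by rewrite pullback_height pullback_atom; apply.
Qed.

Definition sds_comp : sds_hom X Z :=
  @SdsHom R X Z (b \o a) sds_comp_continuous sds_comp_shift sds_comp_base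
    sds_comp_pullback.

End SdsComp.

Lemma sds_compm1 X Y (a : sds_hom X Y) : sds_comp a (sds_id X) = a.
Proof. exact: sds_hom_eq. Qed.

Lemma sds_comp1m X Y (a : sds_hom X Y) : sds_comp (sds_id Y) a = a.
Proof. exact: sds_hom_eq. Qed.

Lemma sds_compA X Y Z W (c : sds_hom Z W) (b : sds_hom Y Z) (a : sds_hom X Y) :
  sds_comp c (sds_comp b a) = sds_comp (sds_comp c b) a.
Proof. exact: sds_hom_eq. Qed.

Definition SDS : category :=
  @Category (sds R) (@sds_hom R) sds_id sds_comp sds_compm1 sds_comp1m sds_compA.

End SdsTheory.

(** * The edge set E(P, Q) *)

Section KREdges.
Variables (X : topologicalType) (phi : X -> X) (x0 : X) (P Q : towers X).
Hypotheses (KP : is_KR phi x0 P) (KQ : is_KR phi x0 Q).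

Definition crosses (S : 'I_(ntowers P)) (T : 'I_(ntowers Q)) (k : nat) : Prop :=
  (k + height S <= height T)%N /\
  forall j, (j < height S)%N -> atom T (k + j) `<=` atom S j.

(* As towers are non-empty, the offset k of an edge is less than the height of
   its range. *)
Definition KR_edge : finType :=
  {e : 'I_(ntowers P) * {T : 'I_(ntowers Q) & 'I_(height T)} |
    `[< crosses e.1 (tag e.2) (tagged e.2) >]}.

Definition KR_src (e : KR_edge) : 'I_(ntowers P) := (val e).1.
Definition KR_rng (e : KR_edge) : 'I_(ntowers Q) := tag (val e).2.
Definition KR_pos (e : KR_edge) : nat := tagged (val e).2.
Definition KR_le : rel KR_edge :=
  fun e e' => (KR_rng e == KR_rng e') && (KR_pos e <= KR_pos e')%N.

Lemma KR_le_refl : reflexive KR_le.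
Proof. by move=> e; rewrite /KR_le eqxx leqnn. Qed.

Lemma KR_le_trans : transitive KR_le.
Proof.
move=> e2 e1 e3 /andP[/eqP a b] /andP[/eqP c d].
by rewrite /KR_le a c eqxx (leq_trans b d).
Qed.

Lemma KR_le_comparable (e e' : KR_edge) :
  KR_le e e' || KR_le e' e = (KR_rng e == KR_rng e').
Proof.
by rewrite /KR_le [KR_rng e' == _]eq_sym; case: eqP => //= _; exact: leq_total.
Qed.

Lemma KR_le_anti : antisymmetric KR_le.
Proof.
move=> e e' /andP[/andP[/eqP r le1] /andP[_ le2]].
have p : KR_pos e = KR_pos e' by apply/eqP; rewrite eqn_leq le1.
move: r p {le1 le2}; rewrite /KR_rng /KR_pos.
case: e e' => -[S [T k]] c [[S' [T' k']] c'] /= TT; subst T' => kk.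
have {}kk : k = k' by exact: val_inj.
subst k'; apply: val_inj => /=; congr pair.
move: c c' => /asboolP /= [c d] /asboolP /= [c' d'].
have hS := KR_height KP S; have hS' := KR_height KP S'.
have [|-> //] := KR_disjoint KP hS hS'.
have [x Tx] := KR_nonempty KQ (ltn_ord k).
by exists x; split; [apply: d|apply: d'] => //; rewrite addn0.
Qed.

Definition KR_edges : edge_set 'I_(ntowers P) 'I_(ntowers Q) :=
  @EdgeSet _ _ KR_edge KR_src KR_rng KR_le
    KR_le_refl KR_le_anti KR_le_trans KR_le_comparable.

Hypotheses (PQ : refined_by P Q) (tPQ : top Q `<=` top P).

Lemma KR_bottom_sub : bottom Q `<=` bottom P.
Proof. by rewrite -(KR_return KP) -(KR_return KQ); exact: image_subset. Qed.

Lemma top_last (k : 'I_(ntowers P)) j : (j < height k)%N ->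
  atom k j `&` top P !=set0 -> j = (height k).-1.
Proof.
move=> jk [x [xk [k' xk']]].
have hk' := KR_height KP k'; have lk' : ((height k').-1 < height k')%N by case: (height k') hk'.
have [|kk jj] := KR_disjoint KP jk lk'; first by exists x.
by rewrite jj kk.
Qed.

(* If Y_{i+1} meets Z_1, the tower of Z_1 is crossed from there on. *)
Lemma KR_crosses (S : 'I_(ntowers P)) (T : 'I_(ntowers Q)) i :
  (i < height T)%N -> atom T i `&` atom S 0 !=set0 -> crosses S T i.
Proof.
move=> iT [x [xT xS]].
have sub A : forall n, (n < height T)%N -> forall (k : 'I_(ntowers P)) j,
    (j < height k)%N -> A = atom T n -> A `&` atom k j !=set0 -> A `<=` atom k j.
  move=> n nT k j jk -> [y [yT yk]].
  have [|B [k' [j' [jk' ->]]] TB] := PQ (B := atom T n); first by exists T, n.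
  have [|-> ->//] := KR_disjoint KP jk jk'.
  by exists y; split=> //; apply: TB.
have hS := KR_height KP S.
have H j : (j < height S)%N ->
    (i + j < height T)%N /\ atom T (i + j) `<=` atom S j.
  elim: j => [_|j IH jS].
    rewrite addn0; split=> //; apply: (sub _ i) => //.
    by exists x.
  have [jT TS] := IH (ltnW jS).
  have jT' : ((i + j).+1 < height T)%N.
    rewrite ltn_neqAle jT andbT; apply/eqP => E.
    have [y yT] := KR_nonempty KQ jT.
    have : j = (height S).-1.
      apply: top_last; first exact: ltnW.
      exists y; split; first exact: TS.
      by apply: tPQ; exists T; rewrite -E.
    by move: jS => /[swap] ->; rewrite prednK // ltnn.
  rewrite addnS; split=> //.
  by rewrite -(KR_step KQ jT') -(KR_step KP jS); exact: image_subset.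
split; last by move=> j /H[].
have [] := H (height S).-1; first by case: (height S) hS.
by rewrite -ltnS -addnS prednK.
Qed.

Definition KR_edge_of (S : 'I_(ntowers P)) (T : 'I_(ntowers Q))
    (k : 'I_(height T)) (c : crosses S T k) : KR_edges :=
  exist _ (S, Tagged (fun T => 'I_(height T)) k) (introT (asboolP _) c).

Lemma KR_edges_src (S : 'I_(ntowers P)) : exists e : KR_edges, src e = S.
Proof.
have [x xS] := KR_nonempty KP (KR_height KP S).
have [T [i [iT xT]]] := KR_cover KQ x.
have c : crosses S T (Ordinal iT) by apply: KR_crosses => //; exists x.
by exists (KR_edge_of c).
Qed.

Lemma KR_edges_rng (T : 'I_(ntowers Q)) : exists e : KR_edges, rng e = T.
Proof.
have hT := KR_height KQ T; have [x xT] := KR_nonempty KQ hT.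
have [|S xS] := KR_bottom_sub (t := x); first by exists T.
have c : crosses S T (Ordinal hT) by apply: KR_crosses => //; exists x.
by exists (KR_edge_of c).
Qed.

End KREdges.

(** * The functor P *)

Section PObj.
Variables (R : realType) (X : sds R).

Definition P_vert (n : nat) : finType := 'I_(ntowers (part X n)).
Definition P_edges (n : nat) : edge_set (P_vert n) (P_vert n.+1) :=
  KR_edges (part_KR X n) (part_KR X n.+1).

Lemma part_topS n : top (part X n.+1) `<=` top (part X n).
Proof.
case: n => [|n]; last exact: part_top.
move=> x _; have [k _] := KR_base (part_KR X 0).
have h := KR_height (part_KR X 0) k.
have : atoms (part X 0) (atom k (height k).-1).
  by exists k, (height k).-1; split=> //; case: (height k) h.
by rewrite part0 => kT; exists k; rewrite kT.
Qed.

Lemma P_src n (v : P_vert n) : exists e : P_edges n, src e = v.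
Proof. exact: KR_edges_src (@part_refined _ X n) (@part_topS n) v. Qed.

Lemma P_rng n (w : P_vert n.+1) : exists e : P_edges n, rng e = w.
Proof. exact: KR_edges_rng (@part_refined _ X n) (@part_topS n) w. Qed.

Lemma P_vert_nonempty n : (0 < #|P_vert n|)%N.
Proof.
by have [k _] := KR_base (part_KR X n); apply/card_gt0P; exists k.
Qed.

Lemma P_vert_root : #|P_vert 0| = 1%N.
Proof.
apply/eqP; rewrite eqn_leq P_vert_nonempty andbT.
apply/card_le1_eqP => k k' _ _.
have KR := part_KR X 0.
have full (l : P_vert 0) : atom l 0 = [set: X].
  have : atoms (part X 0) (atom l 0) by exists l, 0%N; split=> //; exact: KR_height KR l.
  by rewrite part0.
have [|//] := KR_disjoint KR (KR_height KR k) (KR_height KR k').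
by rewrite !full; exists (base X).
Qed.

Lemma P_edges_nonempty n : (0 < #|P_edges n|)%N.
Proof.
have /card_gt0P[v _] := P_vert_nonempty n.
by have [e _] := P_src v; apply/card_gt0P; exists e.
Qed.

Definition P_obj : bratteli :=
  @Bratteli P_vert P_edges P_vert_nonempty P_vert_root P_edges_nonempty
    P_src P_rng.

End PObj.

Section PMor.
Variables (R : realType) (X Y : sds R) (a : sds_hom X Y).

(* Admissible choices of (f_n). *)
Definition P_index (f : nat -> nat) : Prop :=
  [/\ f 0%N = 0%N, forall n, (f n <= f n.+1)%N,
      forall N, exists n, (N < f n)%N &
      forall n, refined_by (pullback a (part Y n)) (part X (f n)) /\
                top (part X (f n)) `<=` top (pullback a (part Y n))].

Definition P_mor_edges (n m : nat) :
    edge_set (bvert (P_obj Y) n) (bvert (P_obj X) m) :=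
  KR_edges (sds_pullback a n) (part_KR X m).

Definition is_P_premor (f : nat -> nat) (p : premorphism (P_obj Y) (P_obj X)) :
    Prop :=
  pidx p = f /\ forall n, pedges p n = P_mor_edges n (pidx p n).

End PMor.

(* Main.v *)
Require Import Defs.
From mathcomp Require Import all_boot reals.
From mathcomp Require Import all_classical topology.

Set Implicit Arguments.
Unset Strict Implicit.
Unset Printing Implicit Defensive.

Local Open Scope classical_set_scope.

(** Everything reduces to the edge sets E(P, Q) of nested Kakutani-Rokhlin
    partitions, meaning that P <= Q and that the top of P contains the top of Q.
    Three facts about them carry the argument.
    - Composition ([KR_edges_comp]): E(P, Q) o E(Q, R) is isomorphic to E(P, R).
      A tower U of R is a concatenation of towers of Q, so every level of U lies
      in exactly one crossing of U by a tower T of Q ([crossing_of_atom]), and a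
      crossing of U by a tower of P takes place inside one of these. The offsets
      add up, and the order is the right one because different crossings of U by
      towers of Q occupy disjoint intervals of levels ([crosses_disjoint]).
    - Pullback ([pullback_edges]): E(a^-1 P, a^-1 Q) is isomorphic to E(P, Q),
      because the inverse images of atoms are non-empty.
    - Cofinality ([part_eventually_nested]): by compactness, for every
      Kakutani-Rokhlin partition Q of X, the pair Q, P_n is nested for all but
      finitely many n.

    The first two give E_{k,l} = E(P_k, P_l) ([P_obj_bpaths]) and show that
    composing E(a^-1 Q_n, P_m) with paths on either side gives an edge set of the
    same form ([P_mor_edges_left], [P_mor_edges_right]). This is the commutation
    relation of premorphisms. It also makes any two premorphisms with edge sets
    isomorphic to E(a^-1 Q_n, P_m) equivalent, whatever the levels m = f_n are
    ([realizes_equiv]); call such a premorphism a realization of a. The third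
    fact provides the sequences (f_n). Functoriality follows, as the identity
    premorphism realizes the identity map and the composite of realizations of a
    and b realizes the composite map. *)

(** * Edge sets described by positions *)

(** [F] is, up to isomorphism, the set of triples (s, t, k) with [c s t k],
    ordered by the position k over each range t. *)
Definition has_positions (S T : finType) (F : edge_set S T)
    (c : S -> T -> nat -> Prop) : Prop :=
  exists pos : F -> nat,
    [/\ forall e, c (src e) (rng e) (pos e),
        forall s t k, c s t k -> exists e : F,
          [/\ src e = s, rng e = t & pos e = k] &
        forall e e', ele e e' = (rng e == rng e') && (pos e <= pos e')%N].

Lemma has_positions_iso (S T : finType) (F G : edge_set S T)
    (c d : S -> T -> nat -> Prop) :
  (forall s t k, c s t k <-> d s t k) ->
  has_positions F c -> has_positions G d -> F \cong G.
Proof.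
move=> cd [p [pc pF pl]] [q [qd qG ql]].
have [h Hh] := choice (fun e => qG _ _ _ ((cd _ _ _).1 (pc e))).
have [k Hk] := choice (fun e => pF _ _ _ ((cd _ _ _).2 (qd e))).
exists h; split.
- exists k => e.
    have [_ a b] := Hk (h e); have [_ a' b'] := Hh e.
    by apply: ele_anti; rewrite !pl a a' b b' eqxx leqnn.
  have [_ a b] := Hk e; have [_ a' b'] := Hh (k e).
  by apply: ele_anti; rewrite !ql a' a b' b eqxx leqnn.
- by move=> e; have [] := Hh e.
- by move=> e; have [] := Hh e.
- move=> e e'; have [_ a b] := Hh e; have [_ a' b'] := Hh e'.
  by rewrite pl ql a a' b b'.
Qed.

Lemma id_edges_positions (S : finType) :
  has_positions (id_edges S) (fun s t k => s = t /\ k = 0%N).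
Proof.
exists (fun=> 0%N); split=> //.
  by move=> s t k [<- ->]; exists s.
by move=> e e'; rewrite leqnn andbT.
Qed.

(** * Composition of the edge sets E(P, Q) *)

Section KREdges.
Variables (X : topologicalType) (phi : X -> X) (x0 : X).

Lemma KR_edges_positions (P Q : towers X)
    (KP : is_KR phi x0 P) (KQ : is_KR phi x0 Q) :
  has_positions (KR_edges KP KQ) (@crosses X P Q).
Proof.
exists (@KR_pos X P Q); split=> //.
- by move=> e; have /asboolP := valP e.
- move=> s t k c; have [le _] := c.
  have kt : (k < height t)%N.
    by apply: leq_trans le; rewrite -addn1 leq_add2l (KR_height KP).
  by exists (KR_edge_of KP KQ (k := Ordinal kt) c).
Qed.

Lemma KR_atoms_meet (P : towers X) (KP : is_KR phi x0 P)
    (S S' : 'I_(ntowers P)) j j' (A : set X) :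
  (j < height S)%N -> (j' < height S')%N -> A !=set0 ->
  A `<=` atom S j -> A `<=` atom S' j' -> S = S' /\ j = j'.
Proof.
by move=> jS jS' [x Ax] AS AS'; apply: (KR_disjoint KP jS jS'); exists x;
  split; [exact: AS|exact: AS'].
Qed.

Lemma crosses_refl_iff (P : towers X) (KP : is_KR phi x0 P)
    (S T : 'I_(ntowers P)) k : crosses S T k <-> S = T /\ k = 0%N.
Proof.
split=> [[kT c]|[-> ->]]; last by split=> // j _ x.
have hS := KR_height KP S.
have kT' : (k < height T)%N by apply: leq_trans kT; rewrite -addn1 leq_add2l.
have := c _ hS; rewrite addn0 => TS.
by have [<- <-] := KR_atoms_meet KP hS kT' (KR_nonempty KP kT') TS (@subset_refl _ _).
Qed.

Lemma KR_edges_refl (P : towers X) (KP KP' : is_KR phi x0 P) :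
  KR_edges KP KP' \cong id_edges 'I_(ntowers P).
Proof.
exact: has_positions_iso (crosses_refl_iff KP) (KR_edges_positions KP KP')
  (id_edges_positions _).
Qed.

Section Composition.
Variables P Q R : towers X.
Hypotheses (KP : is_KR phi x0 P) (KQ : is_KR phi x0 Q) (KR : is_KR phi x0 R).
Hypotheses (PQ : refined_by P Q) (tPQ : top Q `<=` top P).
Hypotheses (QR : refined_by Q R) (tQR : top R `<=` top Q).

Lemma crosses_trans (S : 'I_(ntowers P)) (T : 'I_(ntowers Q))
    (U : 'I_(ntowers R)) i k :
  crosses S T i -> crosses T U k -> crosses S U (k + i).
Proof.
move=> [iT c] [kU d]; split.
  by rewrite -addnA; apply: leq_trans kU; rewrite leq_add2l.
move=> j jS; rewrite -addnA; apply: subset_trans (c _ jS); apply: d.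
by apply: leq_trans iT; rewrite ltn_add2l.
Qed.

(** Every level of a tower of [R] lies in a crossing by a tower of [Q]. The
    induction goes up the tower: above the last level of a crossing comes the
    image of the top of [Q], which is its bottom, and there a new crossing
    starts. *)
Lemma crossing_of_atom (U : 'I_(ntowers R)) k : (k < height U)%N ->
  exists (T : 'I_(ntowers Q)) i,
    [/\ (i <= k)%N, (i < height T)%N & crosses T U (k - i)].
Proof.
have start n : (n < height U)%N -> atom U n `<=` bottom Q ->
    exists T : 'I_(ntowers Q), (0 < height T)%N /\ crosses T U n.
  move=> nU UQ; have [x xU] := KR_nonempty KR nU.
  have [T xT] := UQ _ xU; exists T; split; first exact: KR_height KQ T.
  by apply: (KR_crosses KQ KR QR tQR nU); exists x.
elim: k => [|k IH] kU.
  have [|T [hT c]] := start _ kU; last by exists T, 0%N; split.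
  move=> x xU; apply: (KR_bottom_sub KQ KR tQR); by exists U.
have [T [i [ik iT c]]] := IH (ltnW kU).
have [iT'|Ti] := ltnP i.+1 (height T).
  by exists T, i.+1; split=> //; rewrite subSS.
have [|T' [hT' c']] := start _ kU; last by exists T', 0%N; split.
rewrite -(KR_step KR kU) -(KR_return KQ); apply: image_subset.
have [_ /(_ _ iT)] := c; rewrite subnK // => UT x /UT xT.
have hT : height T = i.+1 by apply/eqP; rewrite eqn_leq Ti iT.
by exists T; rewrite hT.
Qed.

(** Crossings of one tower at different positions do not overlap. *)
Lemma crosses_disjoint (T T' : 'I_(ntowers Q)) (U : 'I_(ntowers R)) k k' :
  crosses T U k -> crosses T' U k' -> (k < k')%N -> (k + height T <= k')%N.
Proof.
move=> [kU c] [kU' c'] kk; rewrite leqNgt; apply/negP => lt.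
have jT : (k' - k < height T)%N by rewrite ltn_subLR // ltnW.
have hT' := KR_height KQ T'.
have k'U : (k' < height U)%N by apply: leq_trans lt kU.
have := c _ jT; have := c' _ hT'; rewrite addn0 subnKC ?(ltnW kk) // => a b.
have [_ /eqP] := KR_atoms_meet KQ jT hT' (KR_nonempty KR k'U) b a.
by rewrite subn_eq0 leqNgt kk.
Qed.

Lemma crosses_comp_positions (F : edge_set 'I_(ntowers P) 'I_(ntowers Q))
    (G : edge_set 'I_(ntowers Q) 'I_(ntowers R)) :
  has_positions F (@crosses X P Q) -> has_positions G (@crosses X Q R) ->
  has_positions (F \circ G) (@crosses X P R).
Proof.
move=> [p [pc ps pl]] [q [qc qs ql]].
exists (fun e => (q (val e).2 + p (val e).1)%N); split.
- case=> -[e g] /= eg; apply: crosses_trans (pc e) _.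
  by rewrite (eqP eg); apply: qc.
- move=> S U k c; have [kU cc] := c; have hS := KR_height KP S.
  have kU' : (k < height U)%N by apply: leq_trans kU; rewrite -addn1 leq_add2l.
  have [T [i [ik iT d]]] := crossing_of_atom kU'.
  have [x xU] := KR_nonempty KR kU'.
  (* Z_1 meets level i of T, so the whole crossing by S happens inside T. *)
  have ST : crosses S T i.
    apply: (KR_crosses KP KQ PQ tPQ iT); exists x; split.
      by have [_ /(_ _ iT)] := d; rewrite subnK //; apply.
    by have := cc _ hS; rewrite addn0; apply.
  have [e [eS eT ei]] := ps _ _ _ ST; have [g [gT gU gk]] := qs _ _ _ d.
  have eg : rng e == src g by rewrite eT gT.
  by exists (comp_pair eg); split=> //=; rewrite ei gk subnK.
- (* The position of e is less than the height of src g = rng e, and the crossing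
     of g' starts only above the crossing of g. *)
  have before e e' g g' : rng e = src g -> rng g = rng g' -> (q g < q g')%N ->
      (q g + p e < q g' + p e')%N.
    move=> eg rr lt; have := qc g; rewrite rr => c.
    have := crosses_disjoint c (qc g') lt.
    have [+ _] := pc e; rewrite eg => a b.
    apply: leq_trans (leq_addr _ _); apply: leq_trans b.
    rewrite ltn_add2l; apply: leq_trans a.
    by rewrite -addn1 leq_add2l; apply: KR_height KP _.
  case=> -[e g] /[dup] /= /eqP eg ? [[e' g'] /[dup] /= /eqP eg' ?].
  rewrite /comp_le /= ql pl eg eg'; have [gg|ne] := eqVneq g g'.
    by rewrite /= gg !eqxx leq_add2l.
  rewrite /= orbF; have [rr|//] := eqVneq (rng g) (rng g').
  rewrite /=; have [lt|lt|E] := ltngtP (q g) (q g').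
  - by rewrite ltnW // before.
  - by rewrite leqNgt before.
  - case/eqP: ne; apply: ele_anti; by rewrite !ql rr E eqxx leqnn.
Qed.

Lemma KR_edges_comp (KP' : is_KR phi x0 P) (KR' : is_KR phi x0 R) :
  KR_edges KP KQ \circ KR_edges KQ KR \cong KR_edges KP' KR'.
Proof.
apply: has_positions_iso (crosses_comp_positions _ _) (KR_edges_positions _ _);
  by [|exact: KR_edges_positions].
Qed.

End Composition.
End KREdges.

(** * Nested partitions and their pullbacks *)

Lemma refined_by_trans (T : Type) (P Q R : towers T) :
  refined_by P Q -> refined_by Q R -> refined_by P R.
Proof.
move=> PQ QR C /QR[B /PQ[A PA BA] CB]; exists A => //; exact: subset_trans BA.
Qed.

(** The relation between partitions under which E(P, Q) is considered. *)
Definition nested (T : Type) (P Q : towers T) : Prop :=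
  refined_by P Q /\ top Q `<=` top P.

Lemma nested_trans (T : Type) (P Q Q' : towers T) :
  nested P Q -> nested Q Q' -> nested P Q'.
Proof.
move=> [PQ tPQ] [QR tQR]; split; first exact: refined_by_trans QR.
exact: subset_trans tPQ.
Qed.

Lemma KR_top_clopen (T : topologicalType) (phi : T -> T) (x0 : T) (P : towers T) :
  is_KR phi x0 P -> clopen (top P).
Proof.
move=> KP; have cl (k : 'I_(ntowers P)) : clopen (atom k (height k).-1).
  by apply: (KR_clopen KP); rewrite ltn_predL; exact: KR_height KP k.
rewrite (_ : top P = \bigcup_(k in [set: 'I_(ntowers P)]) atom k (height k).-1).
  split; first by apply: bigcup_open => k _; case: (cl k).
  by apply: closed_bigcup => [|k _]; [exact: finite_finset|case: (cl k)].
by apply/seteqP; split=> x [k]; exists k.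
Qed.

Section Pullback.
Variables (S T : Type) (a : S -> T).

Lemma pullback_atoms (Q : towers T) (A : set T) :
  atoms Q A -> atoms (pullback a Q) (a @^-1` A).
Proof.
by move=> [k [j [jk ->]]]; exists k, j; rewrite pullback_height pullback_atom.
Qed.

Lemma pullback_refined (P Q : towers T) :
  refined_by P Q -> refined_by (pullback a P) (pullback a Q).
Proof.
move=> PQ B [k [j [+ ->]]]; rewrite pullback_height pullback_atom => jk.
have [|A PA BA] := PQ (atom (P := Q) k j); first by exists k, j.
exists (a @^-1` A); first exact: pullback_atoms.
exact: preimage_subset.
Qed.

Lemma pullback_top (Q : towers T) : top (pullback a Q) = a @^-1` top Q.
Proof.
by apply/seteqP; split=> x [k xk]; exists k; move: xk;
  rewrite pullback_atom pullback_height.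
Qed.

Lemma pullback_nested (P Q : towers T) :
  nested P Q -> nested (pullback a P) (pullback a Q).
Proof.
move=> [PQ tPQ]; split; first exact: pullback_refined.
by rewrite !pullback_top; exact: preimage_subset.
Qed.

Lemma pullback_comp (U : Type) (b : T -> U) (Q : towers U) :
  pullback (b \o a) Q = pullback a (pullback b Q).
Proof.
by congr Towers; apply/funext => k /=; rewrite -map_comp.
Qed.

Lemma pullback_id (Q : towers T) : pullback id Q = Q.
Proof.
by case: Q => n t; congr Towers; apply/funext => k /=; rewrite map_id.
Qed.

End Pullback.

(** Stated for [Towers t] and [Towers t'], so that both edge sets have the same
    type, sources being indexed by 'I_n. *)
Lemma KR_edges_eql (X : topologicalType) (phi : X -> X) (x0 : X) (n : nat)
    (t t' : 'I_n -> seq (set X)) (Q : towers X) (KP : is_KR phi x0 (Towers t))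
    (KP' : is_KR phi x0 (Towers t')) (KQ : is_KR phi x0 Q) :
  t = t' -> KR_edges KP KQ \cong KR_edges KP' KQ.
Proof.
move=> tt; subst t'.
by apply: has_positions_iso (KR_edges_positions KP KQ) (KR_edges_positions KP' KQ).
Qed.

Lemma pullback_id_edges (X : topologicalType) (phi : X -> X) (x0 : X)
    (P : towers X) (KP' : is_KR phi x0 (pullback id P)) (KP : is_KR phi x0 P) :
  KR_edges KP' KP \cong id_edges 'I_(ntowers P).
Proof.
case: P KP' KP => n t KP' KP.
apply: iso_trans (KR_edges_refl KP KP); apply: KR_edges_eql.
by apply/funext => k /=; rewrite map_id.
Qed.

(** If a^-1(Y) is contained in a^-1(Z), then the atom of [P] containing Y meets
    Z, since a^-1(Y) is non-empty; hence it is Z. *)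
Lemma pullback_crosses (X Y : topologicalType) (phi : X -> X) (psi : Y -> Y)
    (x0 : X) (y0 : Y) (a : X -> Y) (P Q : towers Y)
    (KP : is_KR psi y0 P) (KQ : is_KR phi x0 (pullback a Q))
    (PQ : refined_by P Q) (S : 'I_(ntowers P)) (T : 'I_(ntowers Q)) k :
  crosses S T k <-> crosses (P := pullback a P) (Q := pullback a Q) S T k.
Proof.
rewrite /crosses !pullback_height; split=> -[kT c]; split=> // j jS.
  rewrite !pullback_atom; apply: preimage_subset; exact: c.
have := c _ jS; rewrite !pullback_atom => TS.
have kjT : (k + j < height T)%N by apply: leq_trans kT; rewrite ltn_add2l.
have [|_ [S' [j' [jS' ->]]] TS'] := PQ (atom T (k + j)); first by exists T, (k + j)%N.
have := @KR_nonempty _ _ _ _ KQ T (k + j); rewrite pullback_height => /(_ kjT).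
rewrite pullback_atom => -[x xT].
have [|SS jj] := KR_disjoint KP jS jS'.
  by exists (a x); split; [exact: TS|exact: TS'].
by rewrite SS {2}jj.
Qed.

Lemma pullback_edges (X Y : topologicalType) (phi : X -> X) (psi : Y -> Y)
    (x0 : X) (y0 : Y) (a : X -> Y) (P Q : towers Y)
    (KP : is_KR psi y0 P) (KQ : is_KR psi y0 Q)
    (KP' : is_KR phi x0 (pullback a P)) (KQ' : is_KR phi x0 (pullback a Q)) :
  refined_by P Q -> KR_edges KP KQ \cong KR_edges KP' KQ'.
Proof.
move=> PQ.
exact: has_positions_iso (pullback_crosses KP KQ' PQ) (KR_edges_positions KP KQ)
  (KR_edges_positions KP' KQ').
Qed.

(** * The partitions of an object of SDS *)

Section Sds.
Variable R : realType.
Implicit Types X Y Z : sds R.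

Lemma part_refined_le X m n : (m <= n)%N -> refined_by (part X m) (part X n).
Proof.
elim: n => [|n IH]; first by rewrite leqn0 => /eqP -> A; exists A.
rewrite leq_eqVlt => /predU1P[-> A|mn]; first by exists A.
exact: refined_by_trans (IH mn) (@part_refined _ X n).
Qed.

Lemma part_top_le X m n : (m <= n)%N -> top (part X n) `<=` top (part X m).
Proof.
elim: n => [|n IH]; first by rewrite leqn0 => /eqP ->.
rewrite leq_eqVlt => /predU1P[-> //|mn].
exact: subset_trans (@part_topS _ X n) (IH mn).
Qed.

Lemma P_obj_bpaths X m n : (m <= n)%N ->
  bpaths (P_obj X) m n \cong KR_edges (part_KR X m) (part_KR X n).
Proof.
elim: n => [|n IH].
  rewrite leqn0 => /eqP ->; rewrite bpaths_id.
  exact: iso_sym (KR_edges_refl _ _).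
rewrite leq_eqVlt => /predU1P[->|mn].
  rewrite bpaths_id; exact: iso_sym (KR_edges_refl _ _).
rewrite bpathsS //; apply: iso_trans (iso_comp (IH mn) (iso_refl _)) _.
apply: KR_edges_comp; [exact: part_refined_le|exact: part_top_le|
  exact: part_refined|exact: part_topS].
Qed.

Lemma part_nested X m n : (m <= n)%N -> nested (part X m) (part X n).
Proof. by split; [exact: part_refined_le|exact: part_top_le]. Qed.

(** Both halves of nestedness hold near every point for all large n; by
    compactness they hold everywhere for all large n. For the tops, a point
    other than the base point has a neighbourhood disjoint from some Z_m. *)
Lemma part_eventually_nested X (Q : towers X) : is_KR (shift X) (base X) Q ->
  \forall n \near \oo, nested Q (part X n).
Proof.
move=> KQ.
have /compact_near_coveringP cov := @sds_compact _ X.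
have ref : \forall n \near \oo, [set: X] `<=`
    [set x | exists A B, [/\ atoms Q A, atoms (part X n) B, B x & B `<=` A]].
  apply: cov => x _.
  have [k [j [jk xA]]] := KR_cover KQ x.
  have [oA _] := KR_clopen KQ jk.
  have [_ /(_ x) bas] := part_basis X.
  have [B [[m _ mB] Bx] BA] := bas _ (open_nbhs_nbhs (conj oA xA)).
  have oB : open B by case: mB => l [i [il ->]]; have [] := KR_clopen (part_KR X m) il.
  exists (B, [set n | (m <= n)%N]); first by
    split; [exact: open_nbhs_nbhs|exact: nbhs_infty_ge].
  case=> y n [/= By mn].
  have [l [i [il yC]]] := KR_cover (part_KR X n) y.
  exists (atom k j), (atom l i); split=> //; [by exists k, j|by exists l, i|].
  apply: subset_trans BA.
  have [|B' mB' CB'] := part_refined_le mn (B := atom l i); first by exists l, i.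
  case: mB mB' CB' By => l1 [i1 [il1 ->]] [l2 [i2 [il2 ->]]] CB' By.
  have [|-> -> //] := KR_disjoint (part_KR X m) il1 il2.
  by exists y; split=> //; exact: CB'.
have tops : \forall n \near \oo, [set: X] `<=` top Q `|` ~` top (part X n).
  apply: cov => x _.
  have [->|/eqP xb] := eqVneq x (base X).
    exists (top Q, setT); first by
      split; [apply: open_nbhs_nbhs; split|exact: filterT];
        [by case: (KR_top_clopen KQ)|exact: KR_base KQ].
    by case=> y n [yQ _]; left.
  have [m mx] : exists m, ~ top (part X m) x.
    apply: contrapT => H; apply: xb.
    have : (\bigcap_(n in [set n | (0 < n)%N]) top (part X n)) x.
      by move=> n _; apply: contrapT => nx; apply: H; exists n.
    by rewrite part_top_bigcap.
  exists (~` top (part X m), [set n | (m <= n)%N]).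
    split; last exact: nbhs_infty_ge.
    apply: open_nbhs_nbhs; split=> //; apply: closed_openC.
    by case: (KR_top_clopen (part_KR X m)).
  by case=> y n [/= ym mn]; right => yn; apply: ym; apply: part_top_le yn.
near=> n; split.
  move=> C [l [i [il ->]]].
  have [x xC] := KR_nonempty (part_KR X n) il.
  have : [set: X] `<=` [set x | exists A B, [/\ atoms Q A, atoms (part X n) B, B x & B `<=` A]].
    by near: n.
  move=> /(_ x I)[A [_ [QA [l' [i' [il' ->]]] xB BA]]].
  exists A => //; apply: subset_trans BA.
  by have [|-> ->] := KR_disjoint (part_KR X n) il il'; first by exists x.
have : [set: X] `<=` top Q `|` ~` top (part X n) by near: n.
by move=> H x xn; have [] := H x I.
Unshelve. all: by end_near.
Qed.

Lemma part0_single X (k : 'I_(ntowers (part X 0))) : height k = 1%N.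
Proof.
have KR := part_KR X 0; have hk := KR_height KR k.
apply/eqP; rewrite eqn_leq hk andbT leqNgt; apply/negP => h1.
have full j : (j < height k)%N -> atom k j = setT.
  move=> jk; have : atoms (part X 0) (atom k j) by exists k, j.
  by rewrite part0.
have [|_] := KR_disjoint KR hk h1; last by [].
by rewrite !full //; exists (base X).
Qed.

(** * The premorphisms realizing a morphism of SDS *)

Lemma P_index_exists X Y (a : sds_hom X Y) : exists f, P_index a f.
Proof.
have ex n : exists k, forall m, (k <= m)%N ->
    nested (pullback a (part Y n)) (part X m).
  have [k _ Hk] := part_eventually_nested (sds_pullback a n).
  by exists k => m km; apply: Hk.
have [g Hg] := choice ex.
(* The partial sums make f non-decreasing, and the added n makes it unbounded. *)
pose f n := if n is 0 then 0%N else (\sum_(i < n.+1) g i + n)%N.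
exists f; split=> //.
- case=> [|n] //; rewrite /f [X in (_ <= X + _)%N]big_ord_recr /=.
  by rewrite leq_add // leq_addr.
- by move=> N; exists N.+1; rewrite /f leq_addl.
case=> [|n]; last first.
  by apply: Hg; rewrite /f big_ord_recr /= -addnA addnCA leq_addr.
(* Level 0 of the target is the trivial partition, with which anything nests. *)
split.
  move=> B _; exists setT; last exact: subsetT.
  rewrite -(preimage_setT a); apply: pullback_atoms.
  by rewrite part0.
rewrite pullback_top => x _ /=.
have [k xk] := KR_base (part_KR Y 0).
have hk := KR_height (part_KR Y 0) k.
exists k; have : atoms (part Y 0) (atom k (height k).-1).
  by exists k, (height k).-1; rewrite ltn_predL.
by rewrite part0 => ->.
Qed.

Section Realization.
Variables (X Y : sds R) (a : sds_hom X Y).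

(** E(a^-1 Q_n, P_m) may be used as an edge set from level n to level m. *)
Definition admissible n m := nested (pullback a (part Y n)) (part X m).

Lemma P_mor_edges_right n m m' : (m <= m')%N -> admissible n m ->
  P_mor_edges a n m \circ bpaths (P_obj X) m m' \cong P_mor_edges a n m'.
Proof.
move=> mm [r t]; apply: iso_trans (iso_comp (iso_refl _) (P_obj_bpaths X mm)) _.
by apply: KR_edges_comp => //; [exact: part_refined_le|exact: part_top_le].
Qed.

Lemma P_mor_edges_left n n' m : (n <= n')%N -> admissible n' m ->
  bpaths (P_obj Y) n n' \circ P_mor_edges a n' m \cong P_mor_edges a n m.
Proof.
move=> nn [r t].
have [r' t'] := pullback_nested a (part_nested Y nn).
have paths_pullback : (bpaths (P_obj Y) n n' : edge_set _ _) \cong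
    KR_edges (sds_pullback a n) (sds_pullback a n').
  apply: iso_trans (P_obj_bpaths Y nn) _.
  exact: pullback_edges (part_refined_le nn).
apply: iso_trans (iso_comp paths_pullback (iso_refl _)) _.
exact: KR_edges_comp.
Qed.

Section Premorphism.
Variable f : nat -> nat.
Hypothesis fP : P_index a f.

Let f_adm n : admissible n (f n). Proof. by have [_ _ _] := fP; apply. Qed.

Lemma P_mor_edges_src n (v : bvert (P_obj Y) n) :
  exists e : P_mor_edges a n (f n), src e = v.
Proof. by have [r t] := f_adm n; exact: KR_edges_src r t v. Qed.

Lemma P_mor_edges_rng n (w : bvert (P_obj X) (f n)) :
  exists e : P_mor_edges a n (f n), rng e = w.
Proof. by have [r t] := f_adm n; exact: KR_edges_rng r t w. Qed.

Lemma P_mor_edges_nonempty n : (0 < #|P_mor_edges a n (f n)|)%N.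
Proof.
have /card_gt0P[v _] := P_vert_nonempty Y n.
by have [e _] := P_mor_edges_src v; apply/card_gt0P; exists e.
Qed.

Lemma P_mor_edges_single : #|P_mor_edges a 0 (f 0)| = 1%N.
Proof.
apply/eqP; rewrite eqn_leq P_mor_edges_nonempty andbT.
have [-> _ _ _] := fP.
apply/card_le1_eqP => e e' _ _.
have rr : rng e = rng e'.
  by apply: (card_le1_eqP (A := P_vert X 0)) => //; rewrite P_vert_root.
have pos0 (d : P_mor_edges a 0 0) : KR_pos d = 0%N.
  by apply/eqP; rewrite -leqn0 -ltnS -(part0_single (KR_rng d)); exact: ltn_ord.
have le (d d' : P_mor_edges a 0 0) : rng d = rng d' -> ele d d'.
  by move=> dd; rewrite /= /KR_le !pos0 leqnn andbT; apply/eqP.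
by apply: ele_anti; rewrite !le.
Qed.

Lemma P_mor_edges_comm n :
  bedges (P_obj Y) n \circ P_mor_edges a n.+1 (f n.+1) \cong
  P_mor_edges a n (f n) \circ bpaths (P_obj X) (f n) (f n.+1).
Proof.
have [_ /(_ n) le _ _] := fP.
apply: iso_trans (iso_sym (P_mor_edges_right le (f_adm n))).
apply: iso_trans (P_mor_edges_left (leqnSn n) (f_adm n.+1)).
apply: iso_comp (iso_refl _); rewrite bpathsS // bpaths_id.
exact: iso_sym (iso_comp1m _).
Qed.

Lemma P_premor_exists : exists p, is_P_premor a f p.
Proof.
have [f0 fle funb _] := fP.
by exists (@Premorphism (P_obj Y) (P_obj X) f (fun n => P_mor_edges a n (f n))
  f0 fle funb P_mor_edges_nonempty P_mor_edges_src P_mor_edges_rng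
  P_mor_edges_single P_mor_edges_comm).
Qed.

End Premorphism.

(** [p] consists, up to isomorphism, of edge sets E(a^-1 Q_n, P_m). Allowing
    isomorphisms makes this stable under composition of premorphisms. *)
Definition realizes (p : premorphism (P_obj Y) (P_obj X)) : Prop :=
  forall n, admissible n (pidx p n) /\ pedges p n \cong P_mor_edges a n (pidx p n).

Lemma P_premor_realizes f p : P_index a f -> is_P_premor a f p -> realizes p.
Proof.
move=> [_ _ _ adm] [pf pe] n; split; first by rewrite pf; apply: adm.
by rewrite pe; exact: iso_refl.
Qed.

Lemma realizes_absorbs p q : realizes p -> realizes q -> absorbs p q.
Proof.
move=> Hp Hq n; have [M HM] := pidx_large q (pidx p n).
pose m := maxn n M; exists m.
have nm : (n <= m)%N by rewrite leq_maxl.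
have /ltnW pq : (pidx p n < pidx q m)%N by apply: HM; rewrite leq_maxr.
split=> //; have [pn pe] := Hp n; have [qm qe] := Hq m.
apply: iso_trans (iso_comp (iso_refl _) qe) _.
apply: iso_trans (P_mor_edges_left nm qm) _.
apply: iso_trans (iso_sym (P_mor_edges_right pq pn)) _.
exact: iso_comp (iso_sym pe) (iso_refl _).
Qed.

Lemma realizes_equiv p q : realizes p -> realizes q -> premor_equiv p q.
Proof. by move=> Hp Hq; apply/premor_equivP; split; exact: realizes_absorbs. Qed.

Lemma realizes_exists : exists p, realizes p.
Proof.
have [f fP] := P_index_exists a; have [p pP] := P_premor_exists fP.
by exists p; exact: P_premor_realizes fP pP.
Qed.

(** The class of an arbitrary realization of [a]; by [P_morE] the choice does
    not matter. *)
Definition P_mor : obd_hom (P_obj Y) (P_obj X) :=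
  obd_of (sval (cid realizes_exists)).

Lemma P_morE p : realizes p -> P_mor = obd_of p.
Proof.
rewrite /P_mor; case: cid => q Hq /= Hp; apply/obd_of_eq; exact: realizes_equiv.
Qed.

End Realization.

(** * Functoriality *)

Lemma id_premor_realizes X : realizes (sds_id X) (id_premor (P_obj X)).
Proof.
move=> n; split; first by rewrite /admissible pullback_id; exact: part_nested.
exact: iso_sym (pullback_id_edges (sds_id_pullback X n) (part_KR X n)).
Qed.

Lemma comp_premor_realizes X Y Z (b : sds_hom Y Z) (a : sds_hom X Y) p q :
  realizes b p -> realizes a q -> realizes (sds_comp b a) (comp_premor q p).
Proof.
move=> Hp Hq n; have [[bn tb] pe] := Hp n; have [[am ta] qe] := Hq (pidx p n).
have ba : nested (pullback a (pullback b (part Z n)))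
    (pullback a (part Y (pidx p n))) by exact: pullback_nested.
split; first by rewrite /admissible pullback_comp; exact: nested_trans ba _.
apply: iso_trans (iso_comp pe qe) _.
have KR : is_KR (shift X) (base X) (pullback a (pullback b (part Z n))).
  rewrite -pullback_comp; exact: sds_comp_pullback.
apply: (iso_trans (iso_comp (pullback_edges _ _ KR (sds_pullback a _) bn)
  (iso_refl _))).
case: ba => r t; apply: iso_trans (KR_edges_comp _ _ _ r t am ta KR (part_KR X _)) _.
pose pull2 k := map (preimage a) (map (preimage b) (tower (t := part Z n) k)).
apply: (KR_edges_eql (t := pull2) KR (sds_pullback (sds_comp b a) n)).
by apply/funext => k; rewrite /pull2 -map_comp.
Qed.

End Sds.

Theorem proposition3p7 (R : realType) :
  exists P_mor : forall X Y : SDS R,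
      hom X Y -> hom (P_obj Y : OBD) (P_obj X : OBD),
    [/\ (* admissible sequences (f_n) exist *)
        forall (X Y : SDS R) (a : hom X Y), exists f, P_index a f,
        (* each of them yields an ordered premorphism *)
        forall (X Y : SDS R) (a : hom X Y) (f : nat -> nat),
          P_index a f -> exists p, is_P_premor a f p,
        (* whose class is P(a), independently of the choice of (f_n) *)
        forall (X Y : SDS R) (a : hom X Y) (f : nat -> nat)
          (p : premorphism (P_obj Y) (P_obj X)),
          P_index a f -> is_P_premor a f p -> P_mor X Y a = obd_of p &
        is_contravariant_functor (fun X : SDS R => P_obj X : OBD) P_mor].
Proof.
exists (@P_mor R); split.
- exact: P_index_exists.
- by move=> X Y a f fP; exact: P_premor_exists fP.
- by move=> X Y a f p fP pP; apply: P_morE; exact: P_premor_realizes fP pP.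
split=> [X|X Y Z b a]; first exact/P_morE/id_premor_realizes.
have [p Hp] := realizes_exists b; have [q Hq] := realizes_exists a.
rewrite (P_morE Hp) (P_morE Hq) (P_morE (comp_premor_realizes Hp Hq)).
exact/esym/obd_compE.
Qed.
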